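(* Let $S$ be an idempotent semiring with zero $\mathbf 0$ whose strong interval extension $\mathcal I(S)$ is closed with respect to the operations $\overline\oplus$ and $\overline\odot$. Then $\mathcal I(S)$ is an idempotent semiring with respect to $\overline\oplus$ and $\overline\odot$, with zero $[\mathbf 0,\mathbf 0]$. Moreover: \begin{itemize} \item If $S$ is $a$-complete (respectively, $b$-complete), then $\mathcal I(S)$ is $a$-complete (respectively, $b$-complete). \item If $S$ is commutative, then $\mathcal I(S)$ is commutative. \item If $\mathbf 1$ is unity of $S$, then $[\mathbf 1,\mathbf 1]$ is unity of $\mathcal I(S)$. \item If $S$ is entire, then $\mathcal I(S)$ is entire. \item If $S$ is algebraically closed and $(x\oplus y)^n=x^n\oplus y^n$ for all $x,y\in S$, $n\in\mathbb N$, then $\mathcal I(S)$ is algebraically closed. \item If $S$ satisfies the cancellation condition, then $\mathcal I(S)$ satisfies the cancellation condition. \item If $S$ is a semiring with unity $\mathbf 1$ satisfying the stabilization condition, then $\mathcal I(S)$ satisfies the stabilization condition. \end{itemize}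
   Context: A semiring is a set $S$ with an associative commutative addition $\oplus$ and an associative multiplication $\odot$ that distributes over $\oplus$ on both sides; it is idempotent if $x\oplus x=x$ for all $x$, commutative if $\odot$ is commutative. A unity is an element $\mathbf 1$ with $\mathbf 1\odot x=x\odot\mathbf 1=x$; a zero is an element $\mathbf 0\neq\mathbf 1$ with $\mathbf 0\oplus x=x$ and $\mathbf 0\odot x=x\odot\mathbf 0=\mathbf 0$. Canonical order: $x\preccurlyeq y$ iff $x\oplus y=y$; $x\prec y$ iff $x\preccurlyeq y$ and $x\ne y$. An idempotent semiring $S$ is $a$-complete if for any subset $\{x_\alpha\}\subset S$ (including $\varnothing$) a sum $\bigoplus_\alpha x_\alpha$ $(=\sup_\alpha x_\alpha$ in the canonical order) is defined so that $(\bigoplus_\alpha x_\alpha)\odot y=\bigoplus_\alpha(x_\alpha\odot y)$ and $y\odot(\bigoplus_\alpha x_\alpha)=\bigoplus_\alpha(y\odot x_\alpha)$ for all $y\in S$. An idempotent semiring with zero is $b$-complete if these conditions hold for every nonempty subset bounded from above. A semiring with zero is entire if $x\odot y=\mathbf 0$ implies $x=\mathbf 0$ or $y=\mathbf 0$. Cancellation condition: if $x\neq\mathbf 0$ and $x\odot y=x\odot z$ or $y\odot x=z\odot x$, then $y=z$. $S$ is algebraically closed if $x^n=y$ has a solution $x\in S$ for all $y\in S$, $n\in\mathbb N$ ($\mathbb N$ = positive integers). An idempotent semiring with zero and unity satisfies the stabilization condition if whenever $x\preccurlyeq\mathbf 1$ and $y\ne\mathbf 0$ there is $n_0$ with $x^n\oplus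 y=x^{n_0}\oplus y$ for all $n\ge n_0$. A closed interval in $S$ is $\mathbf x=[\underline{\mathbf x},\overline{\mathbf x}]=\{t\in S:\underline{\mathbf x}\preccurlyeq t\preccurlyeq\overline{\mathbf x}\}$ with $\underline{\mathbf x}\preccurlyeq\overline{\mathbf x}$. $I(S)$ is the set of all closed intervals in $S$, with operations $\mathbf x\,\overline\star\,\mathbf y=[\underline{\mathbf x}\star\underline{\mathbf y},\overline{\mathbf x}\star\overline{\mathbf y}]$, $\star\in\{\oplus,\odot\}$; infinite sums of intervals are $\overline{\bigoplus}_\alpha\mathbf x_\alpha=[\bigoplus_\alpha\underline{\mathbf x}_\alpha,\bigoplus_\alpha\overline{\mathbf x}_\alpha]$. The strong interval extension of $S$ is $\mathcal I(S)=\{\mathbf x\in I(S):\mathbf 0\prec\underline{\mathbf x}\preccurlyeq\overline{\mathbf x}\}\cup\{[\mathbf 0,\mathbf 0]\}$ with the same operations. *)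

(* Defs.v *)
From mathcomp Require Import all_boot.
From mathcomp Require Import boolp classical_sets.

Set Implicit Arguments.
Unset Strict Implicit.
Unset Printing Implicit Defensive.

Local Open Scope classical_set_scope.

(* The semirings considered need not have a unity, hence they are not instances
   of the MathComp semiring structures (which all include one).  The notions
   below are predicates on a pair of operations, so that the same definitions
   apply to a semiring and to its strong interval extension. *)

Section Semirings.
Variables (T : Type) (add mul : T -> T -> T).

Record is_idempotent_semiring : Prop := IsIdempotentSemiring {
  semiring_addA : associative add;
  semiring_addC : commutative add;
  semiring_mulA : associative mul;
  semiring_mulDl : left_distributive mul add;
  semiring_mulDr : right_distributive mul add;
  semiring_addxx : idempotent_op add }.

Definition is_unity (one : T) : Prop := left_id one mul /\ right_id one mul.

(* A semiring with zero need not have a unity; if it has one, it is required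
   to differ from the zero. *)
Record is_zero (zero : T) : Prop := IsZero {
  zero_add : left_id zero add;
  zero_mull : left_zero zero mul;
  zero_mulr : right_zero zero mul;
  zero_neq_unity : forall one, is_unity one -> zero <> one }.

Definition sle (x y : T) : Prop := add x y = y.
Definition slt (x y : T) : Prop := sle x y /\ x <> y.

Definition is_ub (A : set T) (u : T) : Prop := forall x, A x -> sle x u.
Definition is_sum (A : set T) (s : T) : Prop :=
  is_ub A s /\ forall u, is_ub A u -> sle s u.

Definition has_distributive_sum (A : set T) : Prop :=
  exists s, is_sum A s /\
    forall y, is_sum [set mul x y | x in A] (mul s y) /\
              is_sum [set mul y x | x in A] (mul y s).

Definition a_complete : Prop := forall A : set T, has_distributive_sum A.

Definition bounded_nonempty (A : set T) : Prop :=
  A !=set0 /\ exists u, is_ub A u.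

Definition b_complete : Prop :=
  forall A : set T, bounded_nonempty A -> has_distributive_sum A.

Definition entire (zero : T) : Prop :=
  forall x y, mul x y = zero -> x = zero \/ y = zero.

Definition cancellation (zero : T) : Prop :=
  forall x y z, x <> zero -> mul x y = mul x z \/ mul y x = mul z x -> y = z.

(* x ^ n for n > 0; only positive exponents make sense without a unity
   (the value at n = 0 is a dummy and is never used). *)
Definition spow (x : T) (n : nat) : T := iterop n mul x x.

Definition algebraically_closed : Prop :=
  forall (y : T) (n : nat), (0 < n)%N -> exists x, spow x n = y.

Definition stabilization (zero one : T) : Prop :=
  forall x y, sle x one -> y <> zero ->
  exists2 n0 : nat, (0 < n0)%N &
    forall n : nat, (n0 <= n)%N -> add (spow x n) y = add (spow x n0) y.

End Semirings.

Section Intervals.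
Variables (S : Type) (add mul : S -> S -> S) (zero : S).

(* A closed interval is encoded by the pair (lower endpoint, upper endpoint);
   by interval_points_inj this loses nothing. *)
Definition intervals : set (S * S) := [set x | sle add x.1 x.2].

Definition interval_points (x : S * S) : set S :=
  [set t | sle add x.1 t /\ sle add t x.2].

Lemma interval_points_inj (semiS : is_idempotent_semiring add mul)
  (x y : S * S) : intervals x -> intervals y ->
  interval_points x = interval_points y -> x = y.
Proof.
case: x y => [a b] [c d]; rewrite /intervals /sle /= => ab cd E.
have addxx := semiring_addxx semiS; have addC := semiring_addC semiS.
have : interval_points (c, d) a by rewrite -E; split; rewrite /sle /= ?addxx.
have : interval_points (c, d) b by rewrite -E; split; rewrite /sle /= ?addxx.
have : interval_points (a, b) c by rewrite E; split; rewrite /sle /= ?addxx.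
have : interval_points (a, b) d by rewrite E; split; rewrite /sle /= ?addxx.
rewrite /interval_points /sle /= => -[_ db] [ac _] [_ bd] [ca _].
by rewrite -ca addC ac -bd addC db.
Qed.

Definition interval_op (op : S -> S -> S) (x y : S * S) : S * S :=
  (op x.1 y.1, op x.2 y.2).

Definition strong_intervals : set (S * S) :=
  (intervals `&` [set x | slt add zero x.1]) `|` [set (zero, zero)].

Definition closed_under (op : S -> S -> S) : Prop :=
  forall x y, strong_intervals x -> strong_intervals y ->
  strong_intervals (interval_op op x y).

Definition strong_op (op : S -> S -> S) (opP : closed_under op)
    (x y : strong_intervals) : strong_intervals :=
  exist _ (interval_op op (val x) (val y))
    (mem_set (opP _ _ (set_mem (valP x)) (set_mem (valP y)))).

Lemma strong_intervals_point (semiS : is_idempotent_semiring add mul)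
  (zeroS : is_zero add mul zero) (t : S) : strong_intervals (t, t).
Proof.
have [zt|t0] := pselect (zero = t); first by right; rewrite /= zt.
left; split; first exact: (semiring_addxx semiS).
by split=> //; exact: (zero_add zeroS).
Qed.

(* The degenerate interval [t, t]. *)
Definition strong_point (semiS : is_idempotent_semiring add mul)
    (zeroS : is_zero add mul zero) (t : S) : strong_intervals :=
  exist _ (t, t) (mem_set (strong_intervals_point semiS zeroS t)).

(* s is the infinite sum of the intervals in A, defined endpoint by endpoint. *)
Definition is_interval_sum (A : set strong_intervals) (s : strong_intervals) :
    Prop :=
  is_sum add [set (val x).1 | x in A] (val s).1 /\
  is_sum add [set (val x).2 | x in A] (val s).2.

End Intervals.

(* Main.v *)
Require Import Defs.
From mathcomp Require Import all_boot.
From mathcomp Require Import boolp classical_sets.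

(** Both operations and the canonical order on strong intervals act endpoint by
    endpoint, so every property expressed by identities passes from [S] to its
    strong interval extension by looking at the two endpoints separately
    ([strong_interval_eq], [sle_strongE], [lower_spow], [upper_spow]).

    What needs an argument are the hypotheses [x <> 0] and the existence
    statements.  A strong interval is zero as soon as one of its endpoints is
    zero ([lower_eq0], [upper_eq0]); hence a nonzero interval has two nonzero
    endpoints, to which cancellation, entireness and stabilization of [S] apply.
    For the same reason the pair formed by the suprema of the lower and of the
    upper endpoints of a family is again a strong interval: if its lower endpoint
    is zero then every member of the family is the zero interval, and its upper
    endpoint is zero too ([strong_intervals_sum]).  This pair is then the supremum
    of the family, and distributivity is inherited from the endpoints
    ([strong_distributive_sum]).  Finally, an [n]-th root of [[a, b]] is
    [[c, c + d]] with [c] and [d] roots of [a] and [b]: adding [c] restores the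
    order of the endpoints, and [(c + d)^n = a + b = b] by additivity of
    powers. *)

Set Implicit Arguments.
Unset Strict Implicit.
Unset Printing Implicit Defensive.

Local Open Scope classical_set_scope.

Section IdempotentSemiring.
Variables (S : Type) (add mul : S -> S -> S) (zero : S).
Hypothesis semiS : is_idempotent_semiring add mul.

Lemma sle_anti x y : sle add x y -> sle add y x -> x = y.
Proof. by rewrite /sle (semiring_addC semiS) => xy <-; rewrite xy. Qed.

Lemma sle_trans y x z : sle add x y -> sle add y z -> sle add x z.
Proof. by rewrite /sle => xy yz; rewrite -yz (semiring_addA semiS) xy. Qed.

Lemma sle_addr x y : sle add x (add x y).
Proof. by rewrite /sle (semiring_addA semiS) (semiring_addxx semiS). Qed.

Lemma is_sum_unique (A : set S) s t : is_sum add A s -> is_sum add A t -> s = t.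
Proof. by move=> [sub sle_s] [tub tle_t]; apply: sle_anti; auto. Qed.

Hypothesis zeroS : is_zero add mul zero.

Lemma sle0 x : sle add zero x.
Proof. exact: (zero_add zeroS). Qed.

Lemma sle0_eq x : sle add x zero -> x = zero.
Proof. by move=> x0; apply: sle_anti x0 (sle0 x). Qed.

Lemma spow0 n : spow mul zero n = zero.
Proof. by case: n => [|[|n]] //; apply: (zero_mull zeroS). Qed.

End IdempotentSemiring.

Section StrongIntervals.
Variables (S : Type) (add mul : S -> S -> S) (zero : S).
Hypothesis semiS : is_idempotent_semiring add mul.
Hypothesis zeroS : is_zero add mul zero.
Hypothesis addP : closed_under add zero add.
Hypothesis mulP : closed_under add zero mul.

Local Notation intvl := (strong_intervals add zero).
Local Notation iadd := (strong_op addP).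
Local Notation imul := (strong_op mulP).
Local Notation point := (strong_point semiS zeroS).
Local Notation izero := (point zero).
Local Notation lower x := (val x).1.
Local Notation upper x := (val x).2.

Lemma strong_interval_eq (x y : intvl) :
  lower x = lower y -> upper x = upper y -> x = y.
Proof.
move=> xy1 xy2; apply: val_inj.
by rewrite [LHS]surjective_pairing [RHS]surjective_pairing xy1 xy2.
Qed.

Lemma lower_le_upper (x : intvl) : sle add (lower x) (upper x).
Proof.
by have [[]//|->] := set_mem (valP x); apply: (semiring_addxx semiS).
Qed.

(** The strictness in the definition of strong intervals: only the zero interval
    starts at zero. *)
Lemma lower_eq0 (x : intvl) : lower x = zero -> x = izero.
Proof.
move=> x0; have [[_ [_]]|xE] := set_mem (valP x); first by rewrite x0.
by apply: val_inj; rewrite /= xE.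
Qed.

Lemma upper_eq0 (x : intvl) : upper x = zero -> x = izero.
Proof.
move=> x0; apply: lower_eq0; apply: (sle0_eq semiS zeroS).
by have := lower_le_upper x; rewrite x0.
Qed.

Lemma lower_neq0 (x : intvl) : x <> izero -> lower x <> zero.
Proof. by move=> xN0 /lower_eq0. Qed.

Lemma upper_neq0 (x : intvl) : x <> izero -> upper x <> zero.
Proof. by move=> xN0 /upper_eq0. Qed.

Lemma sle_strongE (x y : intvl) :
  sle iadd x y <-> sle add (lower x) (lower y) /\ sle add (upper x) (upper y).
Proof.
split=> [xy|[xy1 xy2]]; last exact: strong_interval_eq.
by split; rewrite /sle -[in RHS]xy.
Qed.

Lemma strong_idempotent_semiring : is_idempotent_semiring iadd imul.
Proof.
case: semiS => addA addC mulA mulDl mulDr addxx.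
split=> [x y z|x y|x y z|x y z|x y z|x]; apply: strong_interval_eq.
- exact: addA.
- exact: addA.
- exact: addC.
- exact: addC.
- exact: mulA.
- exact: mulA.
- exact: mulDl.
- exact: mulDl.
- exact: mulDr.
- exact: mulDr.
- exact: addxx.
- exact: addxx.
Qed.

Lemma strong_zero : is_zero iadd imul izero.
Proof.
case: (zeroS) => add0 mul0l mul0r neq1.
split=> [x|x|x|one one1 zero1].
- by apply: strong_interval_eq; apply: add0.
- by apply: strong_interval_eq; apply: mul0l.
- by apply: strong_interval_eq; apply: mul0r.
(* If [0, 0] were a unity, then 0 would be a unity of S, as the degenerate
   intervals form a copy of S. *)
move: one1; rewrite -zero1 => -[mul1l mul1r].
apply: (neq1 zero) => //; split=> t.
- by have /(congr1 (fun x : intvl => lower x)) := mul1l (point t).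
- by have /(congr1 (fun x : intvl => lower x)) := mul1r (point t).
Qed.

Lemma strong_intervals_sum (A : set intvl) l u :
    is_sum add [set lower x | x in A] l -> is_sum add [set upper x | x in A] u ->
  strong_intervals add zero (l, u).
Proof.
move=> [lub llub] [uub ulub].
have [l0|lN0] := pselect (zero = l).
  suff u0 : u = zero by right; rewrite /= -l0 u0.
  apply: (sle0_eq semiS zeroS); apply: ulub => _ [x Ax <-].
  have -> : x = izero.
    apply: lower_eq0; apply: (sle0_eq semiS zeroS).
    suff : sle add (lower x) l by rewrite -l0.
    by apply: lub; exists x.
  exact: (sle0 zeroS).
left; split; last by split=> //; apply: (sle0 zeroS).
apply: llub => _ [x Ax <-].
by apply: (sle_trans semiS (lower_le_upper x)); apply: uub; exists x.
Qed.

Lemma interval_sum_is_sum (A : set intvl) s :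
  is_interval_sum A s -> is_sum iadd A s.
Proof.
move=> [[lub llub] [uub ulub]]; split=> [x Ax|t tub].
  by apply/sle_strongE; split; [apply: lub | apply: uub]; exists x.
apply/sle_strongE; split; [apply: llub | apply: ulub] => _ [x Ax <-];
  by have /sle_strongE[] := tub x Ax.
Qed.

(** The common core of a- and b-completeness, for one family at a time. *)
Lemma strong_distributive_sum (A : set intvl) :
    has_distributive_sum add mul [set lower x | x in A] ->
    has_distributive_sum add mul [set upper x | x in A] ->
  has_distributive_sum iadd imul A /\
  forall s, is_sum iadd A s <-> is_interval_sum A s.
Proof.
move=> [l [lsum lmul]] [u [usum umul]].
pose s : intvl := exist _ (l, u) (mem_set (strong_intervals_sum lsum usum)).
have sA : is_interval_sum A s by [].
have imageE (f : intvl -> intvl) (g h : S -> S) :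
    (forall x, lower (f x) = g (lower x)) ->
    (forall x, upper (f x) = h (upper x)) ->
  [set lower x | x in [set f x | x in A]] = [set g t | t in [set lower x | x in A]]
  /\
  [set upper x | x in [set f x | x in A]] = [set h t | t in [set upper x | x in A]].
  move=> fg fh; rewrite !image_comp.
  by split; apply: eq_imagel => x _ /=; rewrite ?fg ?fh.
split.
  exists s; split=> [|y]; first exact: interval_sum_is_sum.
  have [[l1 l2] [u1 u2]] := (lmul (lower y), umul (upper y)).
  split; apply: interval_sum_is_sum; rewrite /is_interval_sum.
  - by have [//|//|-> ->] := imageE (imul^~ y) (mul^~ (lower y)) (mul^~ (upper y)).
  - by have [//|//|-> ->] := imageE (imul y) (mul (lower y)) (mul (upper y)).
move=> t; split=> [tA|]; last exact: interval_sum_is_sum.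
by rewrite (is_sum_unique strong_idempotent_semiring tA (interval_sum_is_sum sA)).
Qed.

Lemma bounded_nonempty_endpoints (A : set intvl) : bounded_nonempty iadd A ->
  bounded_nonempty add [set lower x | x in A] /\
  bounded_nonempty add [set upper x | x in A].
Proof.
move=> [[a Aa] [u uub]]; split; split.
- by exists (lower a); exists a.
- by exists (lower u) => _ [x Ax <-]; have /sle_strongE[] := uub x Ax.
- by exists (upper a); exists a.
- by exists (upper u) => _ [x Ax <-]; have /sle_strongE[] := uub x Ax.
Qed.

Lemma strong_unity one : is_unity mul one -> is_unity imul (point one).
Proof.
by move=> [mul1l mul1r]; split=> x; apply: strong_interval_eq;
  [apply: mul1l | apply: mul1l | apply: mul1r | apply: mul1r].
Qed.

Lemma strong_entire : entire mul zero -> entire imul izero.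
Proof.
move=> entS x y /(congr1 (fun x : intvl => upper x)) /entS.
by case=> /upper_eq0; [left | right].
Qed.

Lemma lower_spow (x : intvl) n : lower (spow imul x n) = spow mul (lower x) n.
Proof. by case: n => // n; elim: n => //= -[|n] //= ->. Qed.

Lemma upper_spow (x : intvl) n : upper (spow imul x n) = spow mul (upper x) n.
Proof. by case: n => // n; elim: n => //= -[|n] //= ->. Qed.

Lemma strong_algebraically_closed : algebraically_closed mul ->
    (forall x y n, (0 < n)%N ->
       spow mul (add x y) n = add (spow mul x n) (spow mul y n)) ->
  algebraically_closed imul.
Proof.
move=> rootS powD y n n_gt0.
have [y0|yN0] := pselect (y = izero).
  exists izero; rewrite y0.
  by apply: strong_interval_eq; rewrite (lower_spow, upper_spow) (spow0 zeroS).
have [c cn] := rootS (lower y) n n_gt0; have [d dn] := rootS (upper y) n n_gt0.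
have cdP : strong_intervals add zero (c, add c d).
  left; split; first exact: (sle_addr semiS).
  split=> [|/= c0]; first exact: (sle0 zeroS).
  by apply: (lower_neq0 yN0); rewrite -cn -c0 (spow0 zeroS).
exists (exist _ (c, add c d) (mem_set cdP)).
apply: strong_interval_eq; rewrite (lower_spow, upper_spow) //=.
by rewrite powD // cn dn; apply: lower_le_upper.
Qed.

Lemma strong_cancellation : cancellation mul zero -> cancellation imul izero.
Proof.
move=> cancelS x y z xN0 eqxyz; apply: strong_interval_eq.
- apply: (cancelS (lower x)); first exact: lower_neq0.
  by case: eqxyz => /(congr1 (fun x : intvl => lower x)); [left | right].
- apply: (cancelS (upper x)); first exact: upper_neq0.
  by case: eqxyz => /(congr1 (fun x : intvl => upper x)); [left | right].
Qed.

Lemma strong_stabilization one : stabilization add mul zero one ->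
  stabilization iadd imul izero (point one).
Proof.
move=> stabS x y /sle_strongE[x1 x2] yN0.
have [m m_gt0 mP] := stabS _ _ x1 (lower_neq0 yN0).
have [n n_gt0 nP] := stabS _ _ x2 (upper_neq0 yN0).
exists (maxn m n); first by rewrite leq_max m_gt0.
move=> k; rewrite geq_max => /andP[mk nk].
apply: strong_interval_eq; rewrite /= ?lower_spow ?upper_spow.
- by rewrite mP // mP ?leq_maxl.
- by rewrite nP // nP ?leq_maxr.
Qed.

End StrongIntervals.

Theorem theorem3 (S : Type) (add mul : S -> S -> S) (zero : S)
    (semiS : is_idempotent_semiring add mul)
    (zeroS : is_zero add mul zero)
    (addP : closed_under add zero add)
    (mulP : closed_under add zero mul) :
  let iadd := strong_op addP in
  let imul := strong_op mulP in
  let point := strong_point semiS zeroS in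
  let izero := point zero in
  (is_idempotent_semiring iadd imul /\ is_zero iadd imul izero) /\
  (a_complete add mul ->
     a_complete iadd imul /\
     forall (A : set (strong_intervals add zero)) s,
       is_sum iadd A s <-> is_interval_sum A s) /\
  (b_complete add mul ->
     b_complete iadd imul /\
     forall (A : set (strong_intervals add zero)) s,
       bounded_nonempty iadd A ->
       (is_sum iadd A s <-> is_interval_sum A s)) /\
  (commutative mul -> commutative imul) /\
  (forall one, is_unity mul one -> is_unity imul (point one)) /\
  (entire mul zero -> entire imul izero) /\
  (algebraically_closed mul ->
     (forall (x y : S) (n : nat), (0 < n)%N ->
        spow mul (add x y) n = add (spow mul x n) (spow mul y n)) ->
     algebraically_closed imul) /\
  (cancellation mul zero -> cancellation imul izero) /\
  (forall one, is_unity mul one -> stabilization add mul zero one ->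
     stabilization iadd imul izero (point one)).
Proof.
move=> iadd imul point izero.
split; first by split; [apply: strong_idempotent_semiring | apply: strong_zero].
split=> [complS|].
  have sumP (A : set (strong_intervals add zero)) :=
    strong_distributive_sum semiS zeroS addP mulP
      (complS [set (val x).1 | x in A]) (complS [set (val x).2 | x in A]).
  by split=> A; have [] := sumP A.
split=> [complS|].
  have sumP (A : set (strong_intervals add zero)) (bA : bounded_nonempty iadd A) :=
    let: conj lA uA := bounded_nonempty_endpoints bA in
    strong_distributive_sum semiS zeroS addP mulP (complS _ lA) (complS _ uA).
  by split=> A => [bA|s bA]; have [] := sumP A bA.
split=> [mulC x y|]; first by apply: strong_interval_eq; apply: mulC.
split; first exact: strong_unity.
split; first exact: strong_entire.
split; first exact: strong_algebraically_closed.
split; first exact: strong_cancellation.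
by move=> one _; apply: strong_stabilization.
Qed.
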